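(* Let $(\mathbb{S}_1,d_1)$, $(\mathbb{S}_2,d_2)$ be metric spaces and $A:\mathsf{C}(\mathbb{S}_1)\to\mathsf{C}(\mathbb{S}_2)$ a monotonic map ($C\subseteq C'\implies A(C)\subseteq A(C')$). (1) If $\mathbb{S}_1$ and $\mathbb{S}_2$ are compact, then $A$ is robust if and only if $A$ is Scott continuous. (2) If $\mathbb{S}_1$ and $\mathbb{S}_2$ are discrete metric spaces, then $A$ is robust.
   Context: $\mathsf{C}(\mathbb{S})$ is the set of closed subsets of $\mathbb{S}$, viewed as a complete lattice under reverse inclusion (sups are intersections). For $S\subseteq\mathbb{S}$ and $\delta>0$, $B(S,\delta)=\{y\mid\exists x\in S.\ d(x,y)<\delta\}$ and $S_\delta$ is the closure of $B(S,\delta)$. $A$ is robust iff for every closed $C\subseteq\mathbb{S}_1$ and every $\epsilon>0$ there is $\delta>0$ with $A(C_\delta)\subseteq A(C)_\epsilon$. $A$ is Scott continuous iff $A(\bigcap D)=\bigcap\{A(C)\mid C\in D\}$ for every nonempty family $D$ of closed subsets of $\mathbb{S}_1$ that is directed (for any $C_1,C_2\in D$ there is $C_3\in D$ with $C_3\subseteq C_1\cap C_2$). A discrete metric space means here one with $d(x,y)\geq1$ whenever $x\neq y$ (e.g. $d(x,y)=1$ for $x\neq y$). *)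

(* Defs.v *)
From HB Require Import structures.
From mathcomp Require Import all_boot all_order all_algebra.
From mathcomp Require Import all_classical all_reals topology.

Set Implicit Arguments.
Unset Strict Implicit.
Unset Printing Implicit Defensive.

Import Order.TTheory GRing.Theory Num.Theory.

Local Open Scope classical_set_scope.
Local Open Scope ring_scope.

(* The set C(T) of closed subsets of T. *)
Record closed_sets (T : topologicalType) := ClosedSet {
  closed_set_val :> set T ;
  closed_set_closed : closed closed_set_val
}.

(* Leibniz equality in C(T) is equality of the underlying sets. *)
Lemma closed_sets_eq (T : topologicalType) (C C' : closed_sets T) :
  (C : set T) = C' -> C = C'.
Proof.
case: C C' => [C cC] [C' cC'] /= CC'; case: _ / CC' in cC' *.
by congr ClosedSet; exact: Prop_irrelevance.
Qed.

(* The supremum of D in C(T) ordered by reverse inclusion. *)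
Definition closed_bigcap (T : topologicalType) (D : set (closed_sets T)) :
    closed_sets T :=
  ClosedSet (@closed_bigI T _ D (@closed_set_val T)
    (fun C _ => @closed_set_closed T C)).

Definition monotonic (T1 T2 : topologicalType)
    (A : closed_sets T1 -> closed_sets T2) : Prop :=
  forall C C' : closed_sets T1, C `<=` C' -> A C `<=` A C'.

(* Directedness for reverse inclusion. *)
Definition directed_family (T : topologicalType) (D : set (closed_sets T)) :
    Prop :=
  forall C1 C2, D C1 -> D C2 -> exists2 C3, D C3 & C3 `<=` C1 `&` C2.

Definition scott_continuous (T1 T2 : topologicalType)
    (A : closed_sets T1 -> closed_sets T2) : Prop :=
  forall D : set (closed_sets T1), D !=set0 -> directed_family D ->
    A (closed_bigcap D) = closed_bigcap (A @` D).

Section metric.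
Variable R : realType.

Definition set_ball (T : metricType R) (S : set T) (delta : R) : set T :=
  [set y | exists2 x, S x & mdist x y < delta].

(* S_delta, the closure of B(S, delta). *)
Definition fattening (T : metricType R) (S : set T) (delta : R) :
    closed_sets T :=
  ClosedSet (@closed_closure T (set_ball S delta)).

Definition robust (T1 T2 : metricType R)
    (A : closed_sets T1 -> closed_sets T2) : Prop :=
  forall (C : closed_sets T1) (eps : R), 0 < eps ->
    exists2 delta : R, 0 < delta & A (fattening C delta) `<=` fattening (A C) eps.

(* Uniform discreteness with constant 1, not mere discreteness of the
   topology. *)
Definition discrete_metric (T : metricType R) : Prop :=
  forall x y : T, x <> y -> 1 <= mdist x y.

End metric.

(* Main.v *)
(** For monotone A, both properties say that A commutes with certain filtered
    intersections. Compactness enters through one fact: if the intersection of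
    a directed family of closed sets lies in an open set, then some member of
    the family already does. In S1, a directed family D with intersection K has
    a member inside B(K, delta), so robustness at K gives Scott continuity at D.
    In S2, applying Scott continuity to the fattenings of C, whose intersection
    is C, makes some A(C_delta) lie inside B(A(C), eps). In the discrete case,
    C_1 = C. *)
Require Import Defs.
From mathcomp Require Import all_boot all_order all_algebra.
From mathcomp Require Import all_classical all_reals topology.

Set Implicit Arguments.
Unset Strict Implicit.
Unset Printing Implicit Defensive.

Import Order.TTheory GRing.Theory Num.Theory.

Local Open Scope classical_set_scope.
Local Open Scope ring_scope.

(** If no member lies in [U], the closed sets [B C] are nonempty and, by directedness, form a filter
    base. A cluster point lies in all of them, hence in the intersection of [D] yet outside [U]. *)
Lemma compact_directed_sub_open (T : topologicalType)
    (D : set (closed_sets T)) (U : set T) :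
  compact [set: T] -> D !=set0 -> directed_family D -> open U ->
  closed_bigcap D `<=` U -> exists2 C, D C & C `<=` U.
Proof.
move=> cptT D0 Ddir oU DU; apply: contrapT => noC.
pose B (C : closed_sets T) : set T := C `&` ~` U.
have B0 C : D C -> B C !=set0.
  move=> DC; apply: contrapT => BC0; apply: noC; exists C => // x Cx.
  by apply: contrapT => nUx; apply: BC0; exists x.
have FB : Filter (filter_from D B).
  apply: filter_from_filter => // C1 C2 /Ddir/[apply] -[C3 DC3 C312].
  by exists C3 => // x [/C312[C1x C2x] nUx].
have PFB : ProperFilter (filter_from D B) by exact: filter_from_proper.
have [p [_ clp]] := cptT _ PFB filterT.
have clB C : D C -> B C p.
  move=> DC; have : closed (B C).
    by apply: closedI; [exact: closed_set_closed | rewrite closedC].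
  by apply=> V Vp; apply: clp Vp; exists C.
have [C DC] := D0.
by have [_] := clB C DC; apply; apply: DU => C' /clB[].
Qed.

Section metric.
Context {R : realType} {T : metricType R}.
Implicit Types (S : set T) (C : closed_sets T) (d e : R).

Lemma set_ball_open S d : open (set_ball S d).
Proof.
rewrite openE => y [x Sx xyd].
have d0 : 0 < d - mdist x y by rewrite subr_gt0.
apply: filterS (nbhsx_ballx y _ d0) => z; rewrite ballEmdist /= => yz.
exists x => //; apply: le_lt_trans (metric_triangle x y z) _.
by rewrite addrC -ltrBrDr.
Qed.

Lemma subset_set_ball S d : 0 < d -> S `<=` set_ball S d.
Proof. by move=> d0 x Sx; exists x => //; rewrite mdistxx. Qed.

Lemma subset_fattening C d : 0 < d -> C `<=` fattening C d.
Proof.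
by move=> d0 x Cx; apply: subset_closure; exact: subset_set_ball.
Qed.

Lemma le_fattening S d e : d <= e -> fattening S d `<=` fattening S e.
Proof.
move=> de; apply: closure_subset => y [x Sx xyd].
by exists x => //; exact: lt_le_trans xyd de.
Qed.

Lemma bigcap_fattening C : \bigcap_(d in [set d | 0 < d]) fattening C d `<=` C.
Proof.
move=> y Cy; apply: (@closed_set_closed _ C) => V.
rewrite -nbhs_ballE => -[e /= e0 yeV].
(* One half of [e] covers the step from [y] to a point [z] of the ball around [C], the other half
   the step from [z] to [C]. *)
have e20 : 0 < e / 2 by rewrite divr_gt0.
have [z [[x Cx xz]]] := Cy _ e20 _ (nbhsx_ballx y _ e20).
rewrite ballEmdist /= => yz; exists x; split => //; apply: yeV.
rewrite ballEmdist /=; apply: le_lt_trans (metric_triangle y z x) _.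
by rewrite [e]splitr ltrD// metric_sym.
Qed.

(** Points at distance below 1 coincide, so [set_ball C 1] stays inside [C], and so does its closure
    since [C] is closed. *)
Lemma discrete_fattening1 C : discrete_metric T -> fattening C 1 `<=` C.
Proof.
move=> dT; apply: subset_trans (closure_subset _) (@closed_set_closed _ C).
move=> y [x Cx]; case: (pselect (x = y)) => [<-//|/dT].
by rewrite leNgt => /negP.
Qed.

Definition fattenings C : set (closed_sets T) :=
  [set fattening C d | d in [set d | 0 < d]].

Lemma fattenings_neq0 C : fattenings C !=set0.
Proof. by exists (fattening C 1), 1 => /=. Qed.

Lemma fattenings_directed C : directed_family (fattenings C).
Proof.
move=> _ _ [d /= d0 <-] [e /= e0 <-].
exists (fattening C (Num.min d e)).
  by exists (Num.min d e) => //=; rewrite lt_min d0.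
by move=> x Cx; split; apply: le_fattening Cx; rewrite ge_min lexx ?orbT.
Qed.

Lemma closed_bigcap_fattenings C : closed_bigcap (fattenings C) = C.
Proof.
apply: closed_sets_eq; apply/seteqP; split => y.
  by move=> Cy; apply: bigcap_fattening => d d0; apply: Cy; exists d.
by move=> Cy _ [d d0 <-]; exact: subset_fattening.
Qed.

End metric.

(** Makes the compactness lemma applicable in the target space, to the image of a directed
    family. *)
Lemma monotonic_directed (T1 T2 : topologicalType)
    (A : closed_sets T1 -> closed_sets T2) (D : set (closed_sets T1)) :
  monotonic A -> directed_family D -> directed_family (A @` D).
Proof.
move=> A_mono Ddir _ _ [C1 DC1 <-] [C2 DC2 <-].
have [C3 DC3 C312] := Ddir _ _ DC1 DC2.
exists (A C3); first by exists C3.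
by move=> x AC3x; split; apply: A_mono AC3x => z /C312[].
Qed.

Section robustness.
Context {R : realType} {S1 S2 : metricType R}.
Variable A : closed_sets S1 -> closed_sets S2.
Hypothesis A_mono : monotonic A.

Lemma robust_scott_continuous :
  compact [set: S1] -> robust A -> scott_continuous A.
Proof.
move=> cpt1 Arob D D0 Ddir; apply: closed_sets_eq; apply/seteqP; split => y.
  by move=> Ay _ [C DC <-]; apply: A_mono Ay => x; apply.
(* The inclusion beyond monotonicity: it suffices to reach every fattening of the closed set
   [A (closed_bigcap D)]. *)
move=> AD; apply: bigcap_fattening => e e0.
have [d d0 AKd] := Arob (closed_bigcap D) e e0.
(* The open set is the ball around [closed_bigcap D] whose radius [d] robustness provides. *)
have [C DC CK] := compact_directed_sub_open cpt1 D0 Ddir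
  (@set_ball_open _ _ _ _) (subset_set_ball d0).
apply: AKd; apply: A_mono (AD (A C) _); last by exists C.
exact: subset_trans CK (@subset_closure _ _).
Qed.

Lemma scott_continuous_robust :
  compact [set: S2] -> scott_continuous A -> robust A.
Proof.
move=> cpt2 Asc C e e0.
have AC : closed_bigcap (A @` fattenings C) = A C.
  rewrite -Asc ?closed_bigcap_fattenings//.
    exact: fattenings_neq0.
  exact: fattenings_directed.
(* The member found is the image of some [fattening C d], and this [d] is the required radius. *)
have [||||_ [_ [d d0 <-] <-] ACd] :=
    @compact_directed_sub_open _ (A @` fattenings C) (set_ball (A C) e) cpt2.
- by have [F CF] := fattenings_neq0 C; exists (A F), F.
- by apply: monotonic_directed => //; exact: fattenings_directed.
- exact: set_ball_open.
- by rewrite AC; exact: subset_set_ball.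
by exists d => //; apply: subset_trans ACd (@subset_closure _ _).
Qed.

Lemma discrete_robust : discrete_metric S1 -> robust A.
Proof.
move=> dS1 C e e0; exists 1 => //; apply: subset_trans (subset_fattening e0).
by apply: A_mono; exact: discrete_fattening1.
Qed.

End robustness.

Theorem theorem5 (R : realType) (S1 S2 : metricType R)
    (A : closed_sets S1 -> closed_sets S2) (A_mono : monotonic A) :
  (compact [set: S1] -> compact [set: S2] -> (robust A <-> scott_continuous A))
  /\
  (discrete_metric S1 -> discrete_metric S2 -> robust A).
Proof.
split=> [cpt1 cpt2|dS1 _]; last exact: discrete_robust.
by split; [exact: robust_scott_continuous | exact: scott_continuous_robust].
Qed.
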